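(* Let $k \geq 3$ be an integer, and let $f : \mathbb{N} \rightarrow \mathbb{C}$ be a function satisfying $$f(x_1^2 + \cdots + x_k^2) = f(x_1)^2 + \cdots + f(x_k)^2 \quad \text{for all } x_1, \ldots, x_k \in \mathbb{N}.$$ Then one of the following holds: (1) $f(n) = 0$ for all $n \in \mathbb{N}$; (2) for every $n \in \mathbb{N}$: $f(n) = n$ if there exist $x_1, \ldots, x_k \in \mathbb{N}$ with $n = x_1^2 + \cdots + x_k^2$, and $f(n) \in \{n, -n\}$ otherwise (the sign being chosen independently for each such $n$); (3) for every $n \in \mathbb{N}$: $f(n) = \frac{1}{k}$ if there exist $x_1, \ldots, x_k \in \mathbb{N}$ with $n = x_1^2 + \cdots + x_k^2$, and $f(n) \in \{\frac{1}{k}, -\frac{1}{k}\}$ otherwise (the sign being chosen independently for each such $n$).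
   Context: $\mathbb{N}$ denotes the set of positive integers (so $0 \notin \mathbb{N}$). The function $f$ is an arbitrary function; no multiplicativity is assumed. *)

(* Defs.v *)
From mathcomp Require Import all_boot all_order all_algebra.
From mathcomp Require Import reals complex.

Set Implicit Arguments.
Unset Strict Implicit.
Unset Printing Implicit Defensive.

(* The positive integers are rendered as the n : nat with 0 < n; a function on
   them is a function on nat whose value at 0 is irrelevant. *)

Definition sum_of_pos_squares (k n : nat) : Prop :=
  exists x : 'I_k -> nat, (forall i, 0 < x i) /\ n = \sum_(i < k) x i ^ 2.

(* Main.v *)
Require Import Defs.
From mathcomp Require Import all_boot all_order all_algebra.
From mathcomp Require Import reals complex ring zify.

Set Implicit Arguments.
Unset Strict Implicit.
Unset Printing Implicit Defensive.

Import GRing.Theory Num.Theory.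
Local Open Scope ring_scope.
Local Open Scope complex_scope.

(** The values [a n = f n ^ 2] satisfy [\sum a (x i) = \sum a (y i)] whenever
    [\sum x i ^ 2 = \sum y i ^ 2]. The identities
    [(2m+1)^2 + (m-2)^2 = (2m-1)^2 + (m+2)^2] and
    [(2m)^2 + (m-5)^2 = (2m-4)^2 + (m+3)^2] compute [a n] from smaller
    arguments, and finitely many coincidences between sums of three squares
    leave three degrees of freedom: [a n = A n^2 + B + C [n odd]]. The parity
    term is a genuine solution of the linear relations when [k = 3] (the number
    of odd summands is then [N mod 4]), so there it is excluded by the quadratic
    relation [a N = f N ^ 2]; for [k >= 4] the coincidence
    [1+1+1+25 = 4+4+4+16] excludes it. Finally [f N = A N + k B] on sums of [k]
    squares, and comparing its square with [A N^2 + B] gives [A^2 = A],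
    [A B = 0] and [k^2 B^2 = B]. *)

Definition commutes_with_sumsq (F : fieldType) (k : nat) (f : nat -> F) :=
  forall x : 'I_k -> nat, (forall i, (0 < x i)%N) ->
    f (\sum_(i < k) x i ^ 2)%N = \sum_(i < k) f (x i) ^+ 2.

Lemma sum_of_pos_squares_seq (s : seq nat) : all (ltn 0) s ->
  sum_of_pos_squares (size s) (\sum_(x <- s) x ^ 2)%N.
Proof.
move=> s_gt0; exists (fun i => nth 0%N s i); split=> [i|].
  exact: (allP s_gt0 _ (mem_nth _ (ltn_ord i))).
by rewrite (big_nth 0%N) big_mkord.
Qed.

Lemma commutes_seq (F : fieldType) k (f : nat -> F) (s : seq nat) :
    commutes_with_sumsq k f -> all (ltn 0) s -> size s = k ->
  f (\sum_(x <- s) x ^ 2)%N = \sum_(x <- s) f x ^+ 2.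
Proof.
move=> hf s_gt0 sz_s; subst k.
rewrite (big_nth 0%N) big_mkord [RHS](big_nth 0%N) big_mkord.
by apply: hf => i; exact: (allP s_gt0 _ (mem_nth _ (ltn_ord i))).
Qed.

(** Padding both lists with the same [k - size s] ones makes them two representations of one number
    by [k] squares. Evaluating [f] there in two ways gives the relation, since the contribution of
    the ones cancels. *)
Lemma sum_sq_eq (F : fieldType) k (f : nat -> F) (s t : seq nat) :
    commutes_with_sumsq k f -> all (ltn 0) s -> all (ltn 0) t ->
    (size s <= k)%N -> size t = size s ->
    (\sum_(x <- s) x ^ 2)%N = (\sum_(x <- t) x ^ 2)%N ->
  \sum_(x <- s) f x ^+ 2 = \sum_(x <- t) f x ^+ 2.
Proof.
move=> hf s_gt0 t_gt0 le_s_k sz_t eq_st.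
pose u := nseq (k - size s) 1%N.
have u_gt0 : all (ltn 0) u by rewrite all_nseq orbT.
have E v : all (ltn 0) v -> size v = size s ->
    f (\sum_(x <- v ++ u) x ^ 2)%N = \sum_(x <- v ++ u) f x ^+ 2.
  move=> v_gt0 sz_v; apply: (commutes_seq hf); first by rewrite all_cat v_gt0.
  by rewrite size_cat size_nseq sz_v subnKC.
have := E t t_gt0 sz_t; rewrite big_cat /= -eq_st -big_cat /= E //.
by rewrite !big_cat /=; exact: addIr.
Qed.

(** Strong induction: the first recurrence reaches every odd [n >= 7], the second every even
    [n >= 12], and the base list holds exactly the remaining positive arguments. The shifts keep
    [m + 1] positive. [q] satisfies both recurrences because the arguments on the two sides match in
    parity. *)
Lemma parity_quadratic_of_recurrence (F : fieldType) (a : nat -> F) (A B C : F) :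
    let q n := A * n%:R ^+ 2 + B + C * (odd n)%:R in
    (forall m, a (2 * m + 7)%N + a (m + 1)%N = a (2 * m + 5)%N + a (m + 5)%N) ->
    (forall m, a (2 * m + 12)%N + a (m + 1)%N = a (2 * m + 8)%N + a (m + 9)%N) ->
    (forall n, n \in [:: 1; 2; 3; 4; 5; 6; 8; 10]%N -> a n = q n) ->
  forall n, (0 < n)%N -> a n = q n.
Proof.
move=> q a_odd a_even a_base; elim/ltn_ind=> n IHn n_gt0.
have [|n_big] := boolP (n \in [:: 1; 2; 3; 4; 5; 6; 8; 10]%N).
  exact: a_base.
have [[m def_n] | [m def_n]] :
    (exists m, n = 2 * m + 7)%N \/ (exists m, n = 2 * m + 12)%N.
  rewrite !inE in n_big.
  have [n_odd | n_even] := boolP (odd n).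
    by left; exists ((n - 7) %/ 2)%N; lia.
  by right; exists ((n - 12) %/ 2)%N; lia.
- apply: (addIr (a (m + 1)%N)); rewrite {1}def_n a_odd !IHn; try lia.
  rewrite /q def_n.
  have -> : odd (m + 5) = odd (m + 1) by lia.
  have -> : odd (2 * m + 5) = true by lia.
  have -> : odd (2 * m + 7) = true by lia.
  by ring.
- apply: (addIr (a (m + 1)%N)); rewrite {1}def_n a_even !IHn; try lia.
  rewrite /q def_n.
  have -> : odd (m + 9) = odd (m + 1) by lia.
  have -> : odd (2 * m + 8) = false by lia.
  have -> : odd (2 * m + 12) = false by lia.
  by ring.
Qed.

Lemma commutes_parity_quadratic (F : numFieldType) k (f : nat -> F) :
    (3 <= k)%N -> commutes_with_sumsq k f ->
  exists A B C : F, forall n, (0 < n)%N ->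
    f n ^+ 2 = A * n%:R ^+ 2 + B + C * (odd n)%:R.
Proof.
move=> k_ge3 hf; pose a n := f n ^+ 2.
have rel s t : all (ltn 0) s -> all (ltn 0) t -> (size s <= 3)%N ->
    size t = size s -> (\sum_(x <- s) x ^ 2)%N = (\sum_(x <- t) x ^ 2)%N ->
    \sum_(x <- s) a x = \sum_(x <- t) a x.
  by move=> s_gt0 t_gt0 sz_s; apply: (sum_sq_eq hf) => //; exact: leq_trans k_ge3.
have rel2 x y x' y' : [&& 0 < x, 0 < y, 0 < x' & 0 < y']%N ->
    (x ^ 2 + y ^ 2 = x' ^ 2 + y' ^ 2)%N -> a x + a y = a x' + a y'.
  case/and4P=> ? ? ? ? exy.
  have := rel [:: x; y] [:: x'; y']; rewrite !big_cons !big_nil !addr0 !addn0 /=.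
  by apply=> //; apply/and3P; split.
have rel3 x y z x' y' z' :
    all (ltn 0) [:: x; y; z; x'; y'; z'] ->
    (x ^ 2 + (y ^ 2 + z ^ 2) = x' ^ 2 + (y' ^ 2 + z' ^ 2))%N ->
    a x + (a y + a z) = a x' + (a y' + a z').
  move=> /and5P[? ? ? ? /and3P[? ? _]] exy.
  have := rel [:: x; y; z] [:: x'; y'; z'].
  rewrite !big_cons !big_nil !addr0 !addn0 /=.
  by apply=> //; apply/and4P; split.
have a_odd m : a (2 * m + 7)%N + a (m + 1)%N = a (2 * m + 5)%N + a (m + 5)%N.
  by apply: rel2; [rewrite !addnS | lia].
have a_even m : a (2 * m + 12)%N + a (m + 1)%N = a (2 * m + 8)%N + a (m + 9)%N.
  by apply: rel2; [rewrite !addnS | lia].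
(* Interpolation at 1, 2, 3: the equations are [a 1 = A + B + C], [a 2 = 4 * A + B] and
   [a 3 = 9 * A + B + C]. *)
pose A := (a 3%N - a 1%N) / 8; pose B := a 2%N - 4 * A.
pose C := a 1%N - A - B.
have a1 : a 1%N = A + B + C by rewrite /C; ring.
have a2 : a 2%N = 4 * A + B by rewrite /B; ring.
have a3 : a 3%N = 9 * A + B + C by rewrite /C /A; field.
(* Each further value is isolated in one coincidence whose other terms are known, here 1+1+25 =
   9+9+9. The order matters: [a4] relies on [a5] through 1+16+16 = 4+4+25. *)
have a5 : a 5%N = 25 * A + B + C.
  have -> : a 5%N = a 1%N + (a 1%N + a 5%N) - a 1%N - a 1%N by ring.
  by rewrite (rel3 1 1 5 3 3 3)%N // a1 a3; ring.
have a4 : a 4%N = 16 * A + B.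
  have -> : a 4%N = (a 1%N + (a 4%N + a 4%N) - a 1%N) / 2 by field.
  by rewrite (rel3 1 4 4 2 2 5)%N // a1 a2 a5; field.
have a6 : a 6%N = 36 * A + B.
  have -> : a 6%N = a 1%N + (a 1%N + a 6%N) - a 1%N - a 1%N by ring.
  by rewrite (rel3 1 1 6 2 3 5)%N // a1 a2 a3 a5; ring.
(* Not a base value; it serves [a10] through 1+1+100 = 4+49+49. *)
have a7 : a 7%N = 49 * A + B + C.
  have -> : a 7%N = a 7%N + a 1%N - a 1%N by ring.
  by rewrite (rel2 7 1 5 5)%N // a1 a5; ring.
have a8 : a 8%N = 64 * A + B.
  have -> : a 8%N = a 1%N + (a 1%N + a 8%N) - a 1%N - a 1%N by ring.
  by rewrite (rel3 1 1 8 4 5 5)%N // a1 a4 a5; ring.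
have a10 : a 10%N = 100 * A + B.
  have -> : a 10%N = a 1%N + (a 1%N + a 10%N) - a 1%N - a 1%N by ring.
  by rewrite (rel3 1 1 10 2 7 7)%N // a1 a2 a7; ring.
exists A, B, C; apply: parity_quadratic_of_recurrence => // n.
rewrite !inE; case/or4P=> [||| /or4P[||| /orP[]]] /eqP->; rewrite -/(a _).
all: by rewrite ?a1 ?a2 ?a3 ?a4 ?a5 ?a6 ?a8 ?a10 /=; ring.
Qed.

(** Divided differences: subtracting two equations and cancelling the difference of the roots lowers
    the degree, and doing so twice isolates [p]. *)
Lemma quadratic_three_roots (F : fieldType) (p q r x y z : F) :
    uniq [:: x; y; z] -> p * x ^+ 2 + q * x + r = 0 ->
    p * y ^+ 2 + q * y + r = 0 -> p * z ^+ 2 + q * z + r = 0 ->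
  [/\ p = 0, q = 0 & r = 0].
Proof.
rewrite /= !inE negb_or andbT => /andP[/andP[nxy nxz] nyz] ex ey ez.
have {}ey : p * (x + y) + q = 0.
  apply: (mulfI (_ : x - y != 0)); first by rewrite subr_eq0.
  by rewrite mulr0 -[RHS](subrr 0) -{1}ex -ey; ring.
have {}ez : p * (x + z) + q = 0.
  apply: (mulfI (_ : x - z != 0)); first by rewrite subr_eq0.
  by rewrite mulr0 -[RHS](subrr 0) -{1}ex -ez; ring.
have p0 : p = 0.
  apply: (mulfI (_ : y - z != 0)); first by rewrite subr_eq0.
  by rewrite mulr0 -[RHS](subrr 0) -{1}ey -ez; ring.
have q0 : q = 0 by rewrite p0 mul0r add0r in ey.
by split=> //; rewrite p0 q0 !mul0r !add0r in ex.
Qed.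

Lemma commutes_classification (F : numFieldType) k (f : nat -> F) (A B : F) :
    (0 < k)%N -> commutes_with_sumsq k f ->
    (forall n, (0 < n)%N -> f n ^+ 2 = A * n%:R ^+ 2 + B) ->
  (forall n : nat, (0 < n)%N -> f n = 0)
  \/ (forall n : nat, (0 < n)%N ->
        (sum_of_pos_squares k n -> f n = n%:R)
        /\ (~ sum_of_pos_squares k n -> f n = n%:R \/ f n = - n%:R))
  \/ (forall n : nat, (0 < n)%N ->
        (sum_of_pos_squares k n -> f n = k%:R^-1)
        /\ (~ sum_of_pos_squares k n -> f n = k%:R^-1 \/ f n = - k%:R^-1)).
Proof.
move=> k_gt0 hf fsq.
have fsum n : sum_of_pos_squares k n -> f n = A * n%:R + k%:R * B.
  case=> x [x_gt0 ->]; rewrite hf //.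
  under eq_bigr => i _ do rewrite fsq // -natrX.
  by rewrite big_split /= sumr_const card_ord -mulr_sumr -natr_sum mulr_natl.
have root n : (0 < n)%N -> sum_of_pos_squares k n ->
    (A ^+ 2 - A) * n%:R ^+ 2 + 2 * k%:R * (A * B) * n%:R
      + (k%:R ^+ 2 * B ^+ 2 - B) = 0.
  move=> n_gt0 n_sum; have := fsq n n_gt0; rewrite fsum // => e.
  by rewrite -[RHS](subrr (A * n%:R ^+ 2 + B)) -{1}e; ring.
(* One square [x ^ 2] and [k - 1] ones; [x = 1, 2, 3] supply the three distinct roots that
   annihilate the quadratic of [root]. *)
have sum_ones x : (0 < x)%N -> sum_of_pos_squares k (k + (x ^ 2 - 1)).
  move=> x_gt0; have := @sum_of_pos_squares_seq (x :: nseq k.-1 1%N).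
  rewrite /= x_gt0 all_nseq orbT size_nseq prednK // big_cons big_nseq.
  rewrite iter_addn_0 => /(_ isT); congr (sum_of_pos_squares k _).
  by have := expn_gt0 x 2; rewrite x_gt0 /=; lia.
have k_neq0 : k%:R != 0 :> F by rewrite pnatr_eq0 -lt0n.
have [A2 AB B2] : [/\ A ^+ 2 - A = 0, 2 * k%:R * (A * B) = 0
                     & k%:R ^+ 2 * B ^+ 2 - B = 0].
  apply: (quadratic_three_roots (x := (k + (1 ^ 2 - 1))%:R)
    (y := (k + (2 ^ 2 - 1))%:R) (z := (k + (3 ^ 2 - 1))%:R)).
  - by rewrite /= !inE !eqr_nat !eqn_add2l.
  - by apply: root; [lia | exact: sum_ones].
  - by apply: root; [lia | exact: sum_ones].
  - by apply: root; [lia | exact: sum_ones].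
have [A0 | A_neq0] := eqVneq A 0; last first.
  have A1 : A = 1.
    by apply: (mulfI A_neq0); apply/eqP; rewrite mulr1 -expr2 -subr_eq0 A2.
  have B0 : B = 0.
    move/eqP: AB; rewrite A1 mul1r !mulf_eq0 (negPf k_neq0) pnatr_eq0 /=.
    by move/eqP.
  right; left=> n n_gt0; split=> [n_sum|_].
    by rewrite fsum // A1 B0 mulr0 addr0 mul1r.
  have /eqP := fsq n n_gt0; rewrite A1 B0 addr0 mul1r eqf_sqr.
  by case/orP=> /eqP; [left | right].
have [B0 | B_neq0] := eqVneq B 0.
  left=> n n_gt0; apply/eqP; rewrite -sqrf_eq0 fsq // A0 B0.
  by rewrite mul0r addr0.
(* With [A = 0] and [B] nonzero, [B] is the square of [1/k]: sums of [k] squares take the value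
   [k * B = 1/k], and elsewhere only the sign is free. *)
have kkB : k%:R ^+ 2 * B = 1.
  apply: (mulIf B_neq0); apply/eqP.
  by rewrite mul1r -mulrA -expr2 -subr_eq0 B2.
have kB : k%:R * B = k%:R^-1.
  by apply: (mulfI k_neq0); rewrite mulrA -expr2 kkB divff.
have defB : B = k%:R^-1 ^+ 2.
  by rewrite expr2 -{1}kB mulrAC divff // mul1r.
right; right=> n n_gt0; split=> [n_sum|_].
  by rewrite fsum // A0 mul0r add0r.
have /eqP := fsq n n_gt0; rewrite A0 mul0r add0r defB eqf_sqr.
by case/orP=> /eqP; [left | right].
Qed.

Lemma parity_coefficient_eq0 (F : numFieldType) k (f : nat -> F) (A B C : F) :
    (3 <= k)%N -> commutes_with_sumsq k f ->
    (forall n, (0 < n)%N -> f n ^+ 2 = A * n%:R ^+ 2 + B + C * (odd n)%:R) ->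
  C = 0.
Proof.
move=> k_ge3 hf fsq; have [k_ge4 | k_lt4] := leqP 4 k.
  (* All entries are odd on one side and even on the other, so the [A] and [B] terms cancel and
     [4 * C = 0] remains. *)
  have := sum_sq_eq (s := [:: 1; 1; 1; 5]%N) (t := [:: 2; 2; 2; 4]%N) hf.
  rewrite !big_cons !big_nil !fsq //= => /(_ isT isT k_ge4 erefl erefl) e.
  apply: (mulfI (_ : 4 != 0)); first by rewrite pnatr_eq0.
  by rewrite mulr0; move/eqP: e; rewrite -subr_eq0 => /eqP <-; ring.
have {k_ge3 k_lt4} k3 : k = 3%N by lia.
subst k.
have val x y z n c : all (ltn 0) [:: x; y; z] ->
    (x ^ 2 + (y ^ 2 + z ^ 2))%N = n -> (odd x + odd y + odd z)%N = c ->
    A * n%:R ^+ 2 + B + C * (odd n)%:R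
    = (A * n%:R + 3 * B + C * c%:R) ^+ 2.
  move=> xyz_gt0 <- <-; have /and4P[x_gt0 y_gt0 z_gt0 _] := xyz_gt0.
  rewrite -fsq; last by rewrite addn_gt0 expn_gt0 [(0 < x)%N]x_gt0.
  have := commutes_seq hf xyz_gt0 erefl; rewrite !big_cons !big_nil addn0 addr0.
  by move=> ->; rewrite !fsq //; congr (_ ^+ 2); ring.
(* Triples of even numbers make [C] disappear from [val]; 12, 24 and 36 then determine the relations
   between [A] and [B]. *)
have root x y z n : all (ltn 0) [:: x; y; z] ->
    (x ^ 2 + (y ^ 2 + z ^ 2))%N = n -> (odd x + odd y + odd z = 0)%N ->
    ~~ odd n ->
    (A ^+ 2 - A) * n%:R ^+ 2 + 6 * (A * B) * n%:R + (9 * B ^+ 2 - B) = 0.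
  move=> xyz_gt0 def_n no_odd /negPf n_even.
  have := val _ _ _ _ _ xyz_gt0 def_n no_odd; rewrite n_even => e.
  by rewrite -[RHS](subrr (A * n%:R ^+ 2 + B + C * 0%:R)) {1}e; ring.
have [A2 AB B2] : [/\ A ^+ 2 - A = 0, 6 * (A * B) = 0 & 9 * B ^+ 2 - B = 0].
  apply: (quadratic_three_roots (x := 12%N%:R) (y := 24%N%:R) (z := 36%N%:R)).
  - by rewrite /= !inE !eqr_nat.
  - exact: (root 2 2 2)%N.
  - exact: (root 2 2 4)%N.
  - exact: (root 2 4 4)%N.
have AB0 : A * B = 0.
  by apply/eqP; move/eqP: AB; rewrite mulf_eq0 pnatr_eq0.
have combo (u v w : F) : u = v -> v - u - w = 0 -> w = 0.
  by move=> -> /eqP; rewrite subrr sub0r oppr_eq0 => /eqP.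
(* The sums 3, 9 and 6 have 3, 1 and 2 odd summands. In each instance of [val] the part free of [C]
   vanishes by [A2], [AB0] and [B2], leaving [C] times a linear form. *)
have e3 : C * (18 * A + 18 * B + 9 * C - 1) = 0.
  apply: (combo _ _ _ (val 1 1 1 3 3 isT erefl erefl)%N).
  transitivity (9 * (A ^+ 2 - A) + 18 * (A * B) + (9 * B ^+ 2 - B)).
    by rewrite /=; ring.
  by rewrite A2 AB0 B2 !mulr0 !addr0.
have e9 : C * (18 * A + 6 * B + C - 1) = 0.
  apply: (combo _ _ _ (val 1 2 2 9 1 isT erefl erefl)%N).
  transitivity (81 * (A ^+ 2 - A) + 54 * (A * B) + (9 * B ^+ 2 - B)).
    by rewrite /=; ring.
  by rewrite A2 AB0 B2 !mulr0 !addr0.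
have e6 : 4 * (C * (6 * A + 3 * B + C)) = 0.
  apply: (combo _ _ _ (val 1 1 2 6 2 isT erefl erefl)%N).
  transitivity (36 * (A ^+ 2 - A) + 36 * (A * B) + (9 * B ^+ 2 - B)).
    by rewrite /=; ring.
  by rewrite A2 AB0 B2 !mulr0 !addr0.
apply: (mulfI (_ : 4 != 0)); first by rewrite pnatr_eq0.
(* The weights 3, -1, -3 cancel [A], [B] and [C] inside the linear forms and leave the constant 4,
   hence [4 * C = 0]. *)
transitivity (3 * (4 * (C * (6 * A + 3 * B + C)))
  - C * (18 * A + 18 * B + 9 * C - 1) - 3 * (C * (18 * A + 6 * B + C - 1))).
  by ring.
by rewrite e3 e6 e9 !mulr0 !subr0.
Qed.

Theorem mainTheorem1 (R : realType) (k : nat) (hk : (3 <= k)%N)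
    (f : nat -> R[i])
    (hf : forall x : 'I_k -> nat, (forall i, (0 < x i)%N) ->
      f (\sum_(i < k) x i ^ 2)%N = \sum_(i < k) f (x i) ^+ 2) :
  (forall n : nat, (0 < n)%N -> f n = 0)
  \/ (forall n : nat, (0 < n)%N ->
        (sum_of_pos_squares k n -> f n = n%:R)
        /\ (~ sum_of_pos_squares k n -> f n = n%:R \/ f n = - n%:R))
  \/ (forall n : nat, (0 < n)%N ->
        (sum_of_pos_squares k n -> f n = k%:R^-1)
        /\ (~ sum_of_pos_squares k n -> f n = k%:R^-1 \/ f n = - k%:R^-1)).
Proof.
have [A [B [C fsq]]] := commutes_parity_quadratic hk hf.
have C0 := parity_coefficient_eq0 hk hf fsq.
apply: (commutes_classification (A := A) (B := B)) => // [|n n_gt0].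
  exact: leq_trans hk.
by rewrite fsq // C0 mul0r addr0.
Qed.
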